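(* Let $S$ be a weak-twist local energy. For all integers $p\ge1$ and $q$, the sets $\mathcal{BM}^+_{q/p}$ and $\mathcal{BM}^-_{q/p}$ are ordered: for all $x,y\in\mathcal{BM}^+_{q/p}$ either $x\le y$ or $y\le x$, and likewise for all $x,y\in\mathcal{BM}^-_{q/p}$ either $x\le y$ or $y\le x$.
   Context: Let $r\ge1$ be an integer and $K,\lambda>0$. A weak-twist local energy is a function $S\in C^2(\mathbb{R}^{r+1})$ of the form $S(\xi_1,\dots,\xi_{r+1})=\sum_{j=1}^r f_j(\xi_1,\xi_{j+1})$ with $f_j\in C^2(\mathbb{R}^2)$ such that for each $1\le j\le r$: (1) $f_j(\nu+1,\mu+1)=f_j(\nu,\mu)$; (2) $\|\partial_{i,k}f_j\|_{\sup}\le K/r$ for $i,k\in\{1,2\}$; (3) $f_j(\nu,\mu)\to\infty$ as $|\nu-\mu|\to\infty$; and, writing $S_i(x):=S(x_i,\dots,x_{i+r})$ for $x\in\mathbb{R}^{\mathbb{Z}}$ and $\partial_{j,k}$ for second derivatives with respect to $x_j,x_k$, (4) (weak twist) $\partial_{j,k}S_i\le 0$ for all $j\ne k$ and $\partial_{i,i+1}S_i<-\lambda<0$, for all $i\in\mathbb{Z}$. For integers $i_0\le i_1$ let $B=[i_0-r,i_1]\subset\mathbb{Z}$, $\mathring{B}=[i_0,i_1]$ and $W_B(x):=\sum_{i\in B}S_i(x)$. A sequence $x\in\mathbb{R}^{\mathbb{Z}}$ is a global minimizer if $W_B(x)\le W_B(x+v)$ for every such $B$ and every $v$ supported in $\mathring{B}$.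 $\mathcal{M}$ is the set of global minimizers. Order: $x\le y$ means $x_i\le y_i$ for all $i$. Translations: $(\tau_{k,l}x)_i:=x_{i-k}+l$ for $k,l\in\mathbb{Z}$. A sequence $x$ is Birkhoff if for all $(k,l)\in\mathbb{Z}^2$ either $\tau_{k,l}x\le x$ or $\tau_{k,l}x\ge x$. Every Birkhoff sequence has a rotation number $\rho(x)=\lim_{n\to\pm\infty}x_n/n$; $\mathcal{B}_\nu$ is the set of Birkhoff sequences with rotation number $\nu$. Define $\mathcal{BM}^+_{q/p}:=\{x\in\mathcal{M}\cap\mathcal{B}_{q/p}\mid \tau_{p,q}x\ge x\}$ and $\mathcal{BM}^-_{q/p}:=\{x\in\mathcal{M}\cap\mathcal{B}_{q/p}\mid \tau_{p,q}x\le x\}$. *)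

(* Defs.v *)
From HB Require Import structures.
From mathcomp Require Import all_boot all_order all_algebra.
From mathcomp Require Import all_classical all_reals all_analysis.

Set Implicit Arguments.
Unset Strict Implicit.
Unset Printing Implicit Defensive.

Import Order.TTheory GRing.Theory Num.Theory.
Import numFieldNormedType.Exports.

Local Open Scope classical_set_scope.
Local Open Scope ring_scope.

Section Defs.
Context {R : realType}.

Definition partial n (i : 'I_n) (F : 'rV[R]_n -> R) (x : 'rV[R]_n) : R :=
  'D_(delta_mx 0 i) F x.

Definition has_partial n (i : 'I_n) (F : 'rV[R]_n -> R) : Prop :=
  forall x, derivable F x (delta_mx 0 i).

Definition C2 n (F : 'rV[R]_n -> R) : Prop :=
  [/\ continuous F,
      forall i, has_partial i F,
      forall i, continuous (partial i F),
      forall i k, has_partial k (partial i F) &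
      forall i k, continuous (partial k (partial i F))].

Definition row2 (a b : R) : 'rV[R]_2 := \row_(k < 2) if k == 0 then a else b.

Definition upd (x : int -> R) (j : int) (t : R) : int -> R :=
  fun m => if m == j then t else x m.

(* Partial derivative, with respect to the variable x_j, of a function on
   bi-infinite sequences. *)
Definition dvar (j : int) (F : (int -> R) -> R) (x : int -> R) : R :=
  derive1 (fun t : R => F (upd x j t)) (x j).

Definition local_term r (S : 'rV[R]_r.+1 -> R) (i : int) (x : int -> R) : R :=
  S (\row_(k < r.+1) x (i + k%:Z)).

(* [lift ord0 j : 'I_r.+1] is the index with value j + 1.  Variables and
   functions f_j are numbered from 0 here, so f j depends on the coordinates
   0 and j + 1 of xi. *)
Definition weak_twist_energy (r : nat) (K lambda : R) (S : 'rV[R]_r.+1 -> R)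
    : Prop :=
  C2 S /\
  exists f : 'I_r -> 'rV[R]_2 -> R,
  [/\ forall xi, S xi = \sum_(j < r) f j (row2 (xi 0 ord0) (xi 0 (lift ord0 j))),
      forall j, [/\ C2 (f j),
        forall nu mu, f j (row2 (nu + 1) (mu + 1)) = f j (row2 nu mu),
        forall (i k : 'I_2) w, `|partial k (partial i (f j)) w| <= K / r%:R &
        forall M : R, exists D : R, forall nu mu,
          D <= `|nu - mu| -> M <= f j (row2 nu mu)],
      forall (i j k : int) (x : int -> R), j != k ->
        dvar k (dvar j (local_term S i)) x <= 0 &
      forall (i : int) (x : int -> R),
        dvar (i + 1) (dvar i (local_term S i)) x < - lambda].

(* W_B for B = [i0 - r, i1], whose interior is [i0, i1]. *)
Definition W_B r (S : 'rV[R]_r.+1 -> R) (i0 i1 : int) (x : int -> R) : R :=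
  \sum_(i \in [set i : int | i0 - r%:Z <= i <= i1]) local_term S i x.

Definition global_minimizer r (S : 'rV[R]_r.+1 -> R) (x : int -> R) : Prop :=
  forall (i0 i1 : int) (v : int -> R), i0 <= i1 ->
    (forall i, ~~ (i0 <= i <= i1) -> v i = 0) ->
    W_B S i0 i1 x <= W_B S i0 i1 (fun i => x i + v i).

Definition seq_le (x y : int -> R) : Prop := forall i, x i <= y i.

Definition tau (k l : int) (x : int -> R) : int -> R :=
  fun i => x (i - k) + l%:~R.

Definition birkhoff (x : int -> R) : Prop :=
  forall k l : int, seq_le (tau k l x) x \/ seq_le x (tau k l x).

Definition rotation_number (x : int -> R) (nu : R) : Prop :=
  (x n%:Z / n%:R @[n --> \oo] --> nu) /\
  (x (- n%:Z) / (- n%:R) @[n --> \oo] --> nu).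

Definition Birkhoff_rot (nu : R) : set (int -> R) :=
  [set x | birkhoff x /\ rotation_number x nu].

Definition BMplus r (S : 'rV[R]_r.+1 -> R) (p q : int) : set (int -> R) :=
  [set x | global_minimizer S x /\ Birkhoff_rot (q%:~R / p%:~R) x /\
           seq_le x (tau p q x)].

Definition BMminus r (S : 'rV[R]_r.+1 -> R) (p q : int) : set (int -> R) :=
  [set x | global_minimizer S x /\ Birkhoff_rot (q%:~R / p%:~R) x /\
           seq_le (tau p q x) x].

Definition ordered (A : set (int -> R)) : Prop :=
  forall x y, A x -> A y -> seq_le x y \/ seq_le y x.

End Defs.

(* Main.v *)
Require Import Defs.
From HB Require Import structures.
From mathcomp Require Import all_boot all_order all_algebra.
From mathcomp Require Import all_classical all_reals all_analysis.
From mathcomp Require Import zify ring lra.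

Set Implicit Arguments.
Unset Strict Implicit.
Unset Printing Implicit Defensive.

Import Order.TTheory GRing.Theory Num.Theory.
Import numFieldNormedType.Exports.
Local Open Scope classical_set_scope.
Local Open Scope ring_scope.

(** The mixed second derivatives of the energy are nonpositive, so the action
    is submodular: replacing two sequences by their pointwise minimum and
    maximum does not increase the sum of their actions
    ([weak_twist_submodular]).  The strict sign between neighbouring sites
    yields a strong comparison principle: two minimizers, one below the other,
    that touch at one site coincide ([minimizer_touch]).  Hence two minimizers
    [x], [y] are ordered as soon as their maximum is a minimizer
    ([minimizers_ordered]), and for this it is enough to bound the action of
    [x] and [y] on large boxes by that of [seq_min x y] and of an arbitrary
    local perturbation of [seq_max x y], up to a vanishing error
    ([ordered_of_box_action]).

    A Birkhoff sequence of rotation number q/p stays within distance 1 of all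
    its translates by multiples of (p, q).  If it lies above or below
    its translate by (p, q), these translates form a bounded monotone family,
    so the sequence is a connection: it is asymptotic, as the index tends to
    minus and plus infinity, to minimizers [a] and [b] fixed by [tau p q]
    ([birkhoff_connects], [connects_minimizer], [connects_tau_fixed]).

    Three action comparisons finish the proof.  Fixed minimizers have the least
    action per period among all fixed sequences, since the cost of splicing at
    the two ends of a long box is bounded ([periodic_minimizer_action_le]);
    therefore fixed minimizers are ordered.  Next, if [M] goes from [a] to [z]
    and [m] from [z] to [b], then [M] followed by a far translate of [m] is a
    competitor for a minimizer [x] going from [a] to [b], and all splices take
    place where the sequences almost agree ([action_connection]).  With
    submodularity this orders [x] with respect to each fixed minimizer between
    [a] and [b], so that none lies strictly between them
    ([connection_avoids_periodic]), and it also orders two connections whose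
    ends at both infinities are ordered in the same sense
    ([connections_ordered_of_le]).  For two connections that both rise or both
    fall, the remaining relative positions of their ends would put an
    end of one strictly between the ends of the other
    ([connections_ordered]). *)

(** * Submodularity of the energy *)

Lemma derive1_le_slope (R : realType) (g : R -> R) (c : R) :
    (forall t, derivable g t 1) -> (forall t, derive1 g t <= c) ->
  forall s t, s <= t -> g t - g s <= c * (t - s).
Proof.
move=> dg gc s t; rewrite le_eqVlt => /predU1P[->|st]; first by
  rewrite !subrr mulr0.
have [||u _ ->] := @MVT _ g (derive1 g) s t st.
- by move=> u _; rewrite derive1E; exact: derivableP.
- apply: derivable_within_continuous => u _; exact: dg.
- by rewrite ler_wpM2r ?gc// subr_ge0 ltW.
Qed.

Definition set_coord (R : realType) n (xi : 'rV[R]_n) (k : 'I_n) (t : R) :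
    'rV[R]_n :=
  \row_m if m == k then t else xi 0 m.

Lemma set_coordE (R : realType) n (xi : 'rV[R]_n) k t s :
  set_coord xi k t = (t - s) *: delta_mx 0 k + set_coord xi k s.
Proof.
apply/rowP => m; rewrite !mxE/=.
by case: eqP => _; rewrite ?mulr1 ?mulr0 ?subrK ?add0r.
Qed.

(** Moving the coordinate [k] and moving along [delta_mx 0 k] give the same
    difference quotients; the next lemmas thereby turn partial derivatives into
    derivatives of one-variable functions. *)
Lemma quotient_set_coord (R : realType) n (F : 'rV[R]_n -> R) k xi t :
  (fun h : R => h^-1 *: ((F \o shift (set_coord xi k t)) (h *: delta_mx 0 k)
     - F (set_coord xi k t))) =
  (fun h : R => h^-1 *: (((fun s => F (set_coord xi k s)) \o shift t) (h *: 1)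
     - F (set_coord xi k t))).
Proof.
apply/funext => h /=; rewrite [set_coord xi k (_ + t)](set_coordE _ _ _ t) addrK.
by rewrite [h *: 1]mulr1.
Qed.

Lemma derivable_set_coord (R : realType) n (F : 'rV[R]_n -> R) k xi t :
  has_partial k F -> derivable (fun s => F (set_coord xi k s)) t 1.
Proof.
by move=> /(_ (set_coord xi k t)); rewrite /derivable quotient_set_coord.
Qed.

Lemma derive1_set_coord (R : realType) n (F : 'rV[R]_n -> R) k xi t :
  derive1 (fun s => F (set_coord xi k s)) t = partial k F (set_coord xi k t).
Proof. by rewrite /partial derive1E /derive quotient_set_coord. Qed.

Lemma dvar_row (R : realType) n (F : 'rV[R]_n -> R) (k : 'I_n) (i : int) x :
  dvar (i + k%:Z) (fun y => F (\row_m y (i + m%:Z))) x =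
  partial k F (\row_m x (i + m%:Z)).
Proof.
rewrite /dvar; set xi := \row_m x _.
have E t : (\row_m upd x (i + k%:Z) t (i + m%:Z)) = set_coord xi k t :> 'rV_n.
  by apply/rowP => m; rewrite !mxE /upd (inj_eq (addrI i)).
under eq_fun do rewrite E.
rewrite derive1_set_coord; congr partial; apply/rowP => m; rewrite !mxE.
by case: eqP => // ->.
Qed.

(** An integrated form of the bound on the mixed derivative: apply the mean value
    theorem in the variable [k] to [partial j S], then in the variable [j] to the
    increment of [S] in the variable [k]. *)
Lemma mixed_partial_cross (R : realType) n (S : 'rV[R]_n -> R) (j k : 'I_n)
    (l : R) :
    k != j -> C2 S -> (forall xi, partial k (partial j S) xi <= - l) ->
  forall (xi : 'rV[R]_n) a a' b b', a <= a' -> b <= b' ->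
  S (set_coord (set_coord xi j a) k b) + S (set_coord (set_coord xi j a') k b')
    + l * (a' - a) * (b' - b) <=
  S (set_coord (set_coord xi j a) k b') + S (set_coord (set_coord xi j a') k b).
Proof.
move=> kj [_ dS _ ddS _] Sl xi a a' b b' aa' bb'.
have rC s t : set_coord (set_coord xi j s) k t =
    set_coord (set_coord xi k t) j s.
  apply/rowP => m; rewrite !mxE; case: (m =P k) => [->|//].
  by rewrite (negbTE kj).
pose g s :=
  S (set_coord (set_coord xi k b') j s) - S (set_coord (set_coord xi k b) j s).
have dg s : derivable g s 1.
  by apply: derivableB; exact: derivable_set_coord.
have g' s : derive1 g s <= - l * (b' - b).
  rewrite derive1E deriveB -?derive1E ?derive1_set_coord;
    [|exact: derivable_set_coord..].
  rewrite -!rC.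
  apply: (@derive1_le_slope _ 
    (fun t => partial j S (set_coord (set_coord xi j s) k t))) => //.
    by move=> t; exact: derivable_set_coord.
  by move=> t; rewrite derive1_set_coord.
have := derive1_le_slope dg g' aa'.
rewrite !rC /g; lra.
Qed.

Definition seq_min (R : realType) (x y : int -> R) : int -> R :=
  fun i => Num.min (x i) (y i).
Definition seq_max (R : realType) (x y : int -> R) : int -> R :=
  fun i => Num.max (x i) (y i).

(** The value [l = 0] is plain submodularity.  The value [l = lambda] is a
    quantitative gain when [x] and [y] cross between [i] and [i + 1]; when they
    do not cross there, the added term is nonnegative. *)
Definition twist_submodular (R : realType) (r : nat) (lambda : R)
    (S : 'rV[R]_r.+1 -> R) : Prop :=
  forall (l : R) (x y : int -> R) (i : int), l = 0 \/ l = lambda ->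
  local_term S i (seq_min x y) + local_term S i (seq_max x y) <=
  local_term S i x + local_term S i y
    + l * (x i - y i) * (x (i + 1) - y (i + 1)).

Definition unit_invariant (R : realType) (r : nat) (S : 'rV[R]_r.+1 -> R) :
    Prop :=
  forall (i : int) (x : int -> R),
  local_term S i (fun j => x j + 1) = local_term S i x.

Section WeakTwist.
Context {R : realType} (r : nat) (K lambda : R) (S : 'rV[R]_r.+1 -> R).
Context (r_gt0 : (0 < r)%N).
Context (lambda_gt0 : 0 < lambda).
Context (S_wt : weak_twist_energy K lambda S).

Lemma mixed_partial_le (k : 'I_r.+1) (c : R) :
    (forall x, dvar k%:Z (dvar 0 (local_term S 0)) x <= c) ->
  forall xi, partial k (partial ord0 S) xi <= c.
Proof.
move=> Hc xi; pose x (m : int) : R := xi 0 (inord `|m|).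
have rx : \row_m x (0 + m%:Z) = xi.
  by apply/rowP => m; rewrite mxE add0r /x absz_nat inord_val.
have := Hc x; rewrite -{1}[k%:Z]add0r.
have -> : dvar 0 (local_term S 0) =
    fun y => partial ord0 S (\row_m y (0 + m%:Z)).
  by apply/funext => y; rewrite -(dvar_row S ord0 0).
by rewrite dvar_row rx.
Qed.

(** [S] is a sum of pair terms [f j], so submodularity may be checked pair by
    pair; the other pair terms cancel in the cross difference of [S] that
    isolates [f j]. *)
Lemma weak_twist_submodular : twist_submodular lambda S.
Proof.
move=> l x y i l_cases; case: S_wt => S_C2 [f [SE _ S_le0 S_twist]].
pose cross j (c : R) := forall a a' b b', a <= a' -> b <= b' ->
  f j (row2 a b) + f j (row2 a' b') + c * (a' - a) * (b' - b) <=
  f j (row2 a b') + f j (row2 a' b).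
have crossP j c :
    (forall xi, partial (lift ord0 j) (partial ord0 S) xi <= - c) ->
    cross j c.
  move=> dS a a' b b' aa' bb'.
  have := mixed_partial_cross (j := ord0) (k := lift ord0 j) isT S_C2 dS 0
    aa' bb'.
  have E s t : S (set_coord (set_coord 0 ord0 s) (lift ord0 j) t) =
      f j (row2 s t) + \sum_(j' < r | j' != j) f j' (row2 s 0).
    rewrite SE (bigD1 j)//= !mxE !eqxx/=; congr (_ + _).
    by apply: eq_bigr => j' j'j; rewrite !mxE/= (inj_eq lift_inj) (negbTE j'j).
  rewrite !E; lra.
have cross0 j : cross j 0.
  apply: crossP; apply: mixed_partial_le => u; rewrite oppr0.
  exact: S_le0.
have minmax j c : 0 <= c -> cross j c -> forall a a' b b',
    f j (row2 (Num.min a a') (Num.min b b'))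
      + f j (row2 (Num.max a a') (Num.max b b')) <=
    f j (row2 a b) + f j (row2 a' b') + c * (a - a') * (b - b').
  move=> c0 cr a a' b b'.
  have [aa'|/ltW aa'] := leP a a'; have [bb'|/ltW bb'] := leP b b'.
  - by rewrite lerDl -mulrA mulr_ge0// mulr_le0// subr_le0.
  - have := cr _ _ _ _ aa' bb'; lra.
  - have := cr _ _ _ _ aa' bb'; lra.
  - by rewrite addrC lerDl -mulrA !mulr_ge0// subr_ge0.
(* The pair of neighbouring sites has index 0; it alone carries [l]. *)
pose j1 : 'I_r := Ordinal r_gt0.
pose c j := if j == j1 then l else 0.
have c_ge0 j : 0 <= c j.
  by rewrite /c; case: eqP => // _; case: l_cases => ->//; exact: ltW.
have cross_c j : cross j (c j).
  rewrite /c; case: eqP => [->|//]; case: l_cases => -> //.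
  apply: crossP; apply: mixed_partial_le => x'; rewrite ltW//.
  exact: (S_twist 0 x').
have local_termE u : local_term S i u =
    \sum_(j < r) f j (row2 (u i) (u (i + (lift ord0 j)%:Z))).
  by rewrite /local_term SE; apply: eq_bigr => j _; rewrite !mxE addr0.
rewrite !local_termE -!big_split /=.
have -> : l * (x i - y i) * (x (i + 1) - y (i + 1)) = \sum_(j < r)
    c j * (x i - y i) * (x (i + (lift ord0 j)%:Z) - y (i + (lift ord0 j)%:Z)).
  rewrite (bigD1 j1)//= big1 ?addr0 => [|j /negbTE jj1].
    by rewrite /c eqxx.
  by rewrite /c jj1 !mul0r.
rewrite -big_split; apply: ler_sum => j _; exact: minmax.
Qed.
End WeakTwist.

(** * The action of a finite block *)

Section Action.
Context {R : realType} (r : nat) (S : 'rV[R]_r.+1 -> R).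
Implicit Types (x y u w : int -> R) (a i : int) (m n : nat).

Definition action a n x : R := \sum_(k < n) local_term S (a + k%:Z) x.
Arguments action a%_R n%_N x.

Lemma W_B_action i0 n x :
  W_B S i0 (i0 + n%:Z) x = action (i0 - r%:Z) (r + n.+1) x.
Proof.
rewrite /W_B /action
  -(big_mkord xpredT (fun k => local_term S (i0 - r%:Z + k%:Z) x)).
pose h (k : nat) : int := i0 - r%:Z + k%:Z.
rewrite -[RHS](big_map h xpredT (fun i => local_term S i x)) [RHS]fsbig_seq.
  congr (\big[_/_]_(_ \in _) _); apply/seteqP; split => i /=.
    move=> /= ib; apply/mapP; exists (absz (i - (i0 - r%:Z))%R);
      last by rewrite /h; lia.
    by rewrite mem_index_iota; lia.
  by move=> /mapP[k]; rewrite mem_index_iota /h => ? ->; lia.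
by rewrite map_inj_uniq ?iota_uniq// /h => k k'; lia.
Qed.

Lemma action_cat a m n x :
  action a (m + n) x = action a m x + action (a + m%:Z) n x.
Proof.
rewrite /action big_split_ord; congr (_ + _).
by apply: eq_bigr => k _ /=; rewrite PoszD addrA.
Qed.

Lemma eq_local_term i x y :
    (forall j, i <= j <= i + r%:Z -> x j = y j) ->
  local_term S i x = local_term S i y.
Proof.
move=> xy; congr S; apply/rowP => k; rewrite !mxE xy//.
by have := ltn_ord k; lia.
Qed.

Lemma eq_action a n x y :
    (forall i, a <= i < a + n%:Z + r%:Z -> x i = y i) ->
  action a n x = action a n y.
Proof.
move=> xy; apply: eq_bigr => k _; apply: eq_local_term => j jb; apply: xy.
by have := ltn_ord k; lia.
Qed.

(** Only the windows that meet the perturbed sites see the perturbation. *)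
Lemma action_perturb c m a n x w :
    c <= a - r%:Z -> a + n%:Z <= c + m%:Z ->
    (forall i, ~~ (a <= i < a + n%:Z) -> w i = x i) ->
  action c m x - action c m w =
  action (a - r%:Z) (r + n) x - action (a - r%:Z) (r + n) w.
Proof.
move=> ca nm xw.
have -> : m = (absz (a - r%:Z - c)%R +
    ((r + n) + absz (c + m%:Z - (a + n%:Z))%R))%N by lia.
rewrite !(action_cat _ (absz _)) !(action_cat _ (r + n)).
have -> : c + (absz (a - r%:Z - c)%R)%:Z = a - r%:Z by lia.
rewrite (@eq_action c _ w x); last by move=> i ib; apply: xw; lia.
rewrite (@eq_action (_ + (r + n)%N%:Z) _ w x); last first.
  by move=> i ib; apply: xw; lia.
ring.
Qed.

Lemma global_minimizerP x : global_minimizer S x <->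
  forall a n w, (forall i, ~~ (a <= i < a + n%:Z) -> w i = x i) ->
  action (a - r%:Z) (r + n) x <= action (a - r%:Z) (r + n) w.
Proof.
split=> [xmin a [|n] w xw|xmin i0 i1 v i01 v0].
- rewrite (@eq_action _ _ w x)// => i _; apply: xw; lia.
- have := xmin a (a + n%:Z) (fun i => w i - x i).
  rewrite !W_B_action (_ : (fun i => x i + (w i - x i)) = w); last first.
    by apply/funext => i; rewrite addrC subrK.
  apply; first lia.
  by move=> i ib; rewrite xw ?subrr//; lia.
- have -> : i1 = i0 + (absz (i1 - i0)%R)%:Z by lia.
  rewrite !W_B_action; apply: xmin => i ib; rewrite v0 ?addr0//; lia.
Qed.

Definition splice a x y : int -> R := fun i => if i < a then x i else y i.

(** The price of passing from [x] to [y] at the site [a], carried by the [r]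
    windows that see both sides. *)
Definition cut_cost a x y : R :=
  action (a - r%:Z) r (splice a x y) - action (a - r%:Z) r x.

Lemma action_splice a m n x y : (r <= m)%N ->
  action a (m + n) (splice (a + m%:Z) x y) =
  action a m x + cut_cost (a + m%:Z) x y + action (a + m%:Z) n y.
Proof.
move=> rm; rewrite action_cat; congr (_ + _); last first.
  by apply: eq_action => i ib; rewrite /splice ifF//; lia.
have split_r z :
    action a m z = action a (m - r) z + action (a + m%:Z - r%:Z) r z.
  have <- : a + (m - r)%N%:Z = a + m%:Z - r%:Z by lia.
  by rewrite -action_cat subnK.
rewrite /cut_cost !split_r (@eq_action a _ (splice _ _ _) x); last first.
  by move=> i ib; rewrite /splice ifT//; lia.
ring.
Qed.

Lemma eq_cut_cost a x x' y y' :
    (forall i, a - r%:Z <= i < a -> x i = x' i) ->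
    (forall i, a <= i < a + r%:Z -> y i = y' i) ->
  action (a - r%:Z) r x = action (a - r%:Z) r x' ->
  cut_cost a x y = cut_cost a x' y'.
Proof.
move=> xx yy E; rewrite /cut_cost E; congr (_ - _).
apply: eq_action => i ib; rewrite /splice; case: ifPn => ia;
  [apply: xx|apply: yy]; lia.
Qed.

(** Replacing [x] by [u] on a block cannot lower the action, and the new action
    differs from that of [u] only by the cost of the two splices. *)
Lemma minimizer_cut x u a n : global_minimizer S x -> (r <= n)%N ->
  action a n x <=
  action a n u + cut_cost a x u + cut_cost (a + n%:Z) u x.
Proof.
move=> /global_minimizerP /(_ a n) xmin rn.
pose g := splice a x (splice (a + n%:Z) u x).
have /xmin : forall i, ~~ (a <= i < a + n%:Z) -> g i = x i.
  by move=> i ib; rewrite /g /splice; case: ifP => //; case: ifP => //; lia.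
have E := @action_splice (a - r%:Z) r n x (splice (a + n%:Z) u x) (leqnn _).
rewrite subrK -/g in E; rewrite E action_cat subrK.
have -> : cut_cost a x (splice (a + n%:Z) u x) = cut_cost a x u.
  by apply: eq_cut_cost => // i ib; rewrite /splice ifT//; lia.
have := @action_splice a n 0 u x rn; rewrite addn0 => ->.
rewrite [X in _ + (_ + X)]/action big_ord0; lra.
Qed.

Context (S_inv : unit_invariant S).

Lemma local_term_tau (k l : int) i x :
  local_term S i (tau k l x) = local_term S (i - k) x.
Proof.
have nat_inv m j z : local_term S j (fun j => z j + m%:R) = local_term S j z.
  elim: m => [|m IH].
    by congr local_term; apply/funext => ?; rewrite addr0.
  rewrite -[RHS]IH -[RHS]S_inv; congr local_term.
  by apply/funext => ?; rewrite -addrA natr1.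
have -> : local_term S (i - k) x = local_term S i (tau k 0 x).
  by congr S; apply/rowP => j; rewrite !mxE /tau addr0; congr x; lia.
case: l => m.
  rewrite -[RHS](nat_inv m); congr local_term.
  by apply/funext => ?; rewrite /tau addr0.
rewrite -[LHS](nat_inv m.+1); congr local_term; apply/funext => ?.
by rewrite /tau addr0 NegzE mulrNz subrK.
Qed.

Lemma action_tau (k l : int) a n x : action a n (tau k l x) = action (a - k) n x.
Proof. by apply: eq_bigr => j _; rewrite local_term_tau addrAC. Qed.

Lemma cut_cost_tau (k l : int) a x y :
  cut_cost a (tau k l x) (tau k l y) = cut_cost (a - k) x y.
Proof.
rewrite /cut_cost action_tau.
have -> : splice a (tau k l x) (tau k l y) = tau k l (splice (a - k) x y).
  by apply/funext => i; rewrite /tau /splice ltrD2r; case: ifP.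
by rewrite action_tau (_ : a - r%:Z - k = a - k - r%:Z)//; lia.
Qed.

Context (S_cont : continuous S).

Definition pointwise_cvg (X : nat -> int -> R) (z : int -> R) : Prop :=
  forall i, X n i @[n --> \oo] --> z i.

Lemma cvg_action X z a n : pointwise_cvg X z ->
  action a n (X N) @[N --> \oo] --> action a n z.
Proof.
move=> Xz; apply: cvg_big => [|k _]; first exact: add_continuous.
have row_cvg : (\row_(j < r.+1) X N (a + k%:Z + j%:Z)) @[N --> \oo] -->
    \row_(j < r.+1) z (a + k%:Z + j%:Z).
  move=> A [P zP PA].
  suff : \forall N \near \oo, forall s t,
      P s t ((\row_(j < r.+1) X N (a + k%:Z + j%:Z)) s t).
    by apply: filterS => N; exact: PA.
  apply: filter_forall => s; apply: filter_forall => t.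
  have := zP s t; rewrite mxE => zPij.
  have XP : \forall N \near \oo, P s t (X N (a + k%:Z + t%:Z)).
    exact: (Xz _ _ zPij).
  by apply: filterS XP => N; rewrite mxE.
rewrite /local_term; apply: continuous_cvg; first exact: S_cont.
exact: row_cvg.
Qed.

(** Splicing is asymptotically free where both sequences have the same limit. *)
Lemma cvg_cut_cost X Y z a : pointwise_cvg X z -> pointwise_cvg Y z ->
  cut_cost a (X N) (Y N) @[N --> \oo] --> (0 : R).
Proof.
move=> Xz Yz; rewrite -(subrr (action (a - r%:Z) r z)); apply: cvgB.
  by apply: cvg_action => i; rewrite /splice; case: (i < a).
exact: cvg_action.
Qed.

End Action.

(** * Strong comparison of minimizers *)

Section StrongOrder.
Context {R : realType} (r : nat) (lambda : R) (S : 'rV[R]_r.+1 -> R).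
Implicit Types (x y : int -> R) (a i j : int).

Context (S_sub : twist_submodular lambda S).

Lemma action_submodular a n x y :
  action S a n (seq_min x y) + action S a n (seq_max x y) <=
  action S a n x + action S a n y.
Proof.
rewrite /action -!big_split; apply: ler_sum => k _ /=.
by have := S_sub x y (a + k%:Z) (or_introl (erefl 0)); rewrite !mul0r addr0.
Qed.

Lemma action_twist a n j x y : a <= j < a + n%:Z ->
  action S a n (seq_min x y) + action S a n (seq_max x y) <=
  action S a n x + action S a n y
    + lambda * (x j - y j) * (x (j + 1) - y (j + 1)).
Proof.
move=> ajn.
have [k ->] : exists k : 'I_n, j = a + k%:Z.
  have jn : (absz (j - a)%R < n)%N by lia.
  by exists (Ordinal jn) => /=; lia.
rewrite /action -!big_split (bigD1 k)//= [in leRHS](bigD1 k)//= [leRHS]addrAC.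
apply: lerD; first by apply: S_sub; right.
apply: ler_sum => m _.
by have := S_sub x y (a + m%:Z) (or_introl (erefl 0)); rewrite !mul0r addr0.
Qed.

Context (S_der : forall k, has_partial k S).

Lemma derivable_local_term j x i t :
  derivable (fun s => local_term S j (upd x i s)) t 1.
Proof.
have [ij|ij] := boolP (j <= i <= j + r%:Z); last first.
  rewrite (_ : (fun s => _) = fun=> local_term S j x); first exact: derivable_cst.
  apply/funext => s; apply: eq_local_term => k kb.
  by rewrite /upd; case: eqP => // ki; move: ij; rewrite -ki kb.
have mr : (absz (i - j)%R < r.+1)%N by lia.
pose m := Ordinal mr.
have -> : (fun s => local_term S j (upd x i s)) =
    fun s => S (set_coord (\row_k x (j + k%:Z)) m s).
  apply/funext => s; congr S; apply/rowP => k; rewrite !mxE /upd.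
  have -> : (k == m) = (j + k%:Z == i); last by [].
  by rewrite -val_eqE /=; apply/eqP/eqP; lia.
exact: derivable_set_coord.
Qed.

Lemma derivable_action a n x i t :
  derivable (fun s => action S a n (upd x i s)) t 1.
Proof.
rewrite (_ : (fun s => _) =
    \sum_(k < n) (fun s => local_term S (a + k%:Z) (upd x i s))); last first.
  by apply/funext => s; rewrite fct_sumE.
by apply: derivable_sum => k; exact: derivable_local_term.
Qed.

Context (r_gt0 : (0 < r)%N).
Context (lambda_gt0 : 0 < lambda).

(** Raise the common value [x i = y i] by [t >= 0].  By the strict twist, the
    increase of the action of [x] exceeds that of [y], which is nonnegative, by
    at least [lambda * (y j - x j) * t].  As [x i] minimizes the differentiable
    function [W], the slope [lambda * (y j - x j)] vanishes. *)
Lemma minimizer_touch_step x y i j : global_minimizer S x ->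
    global_minimizer S y -> seq_le x y -> x i = y i ->
  j = i + 1 \/ j = i - 1 -> x j = y j.
Proof.
move=> xmin ymin xy xyi ij; apply/eqP; rewrite eq_le xy /=.
pose W t := action S (i - r%:Z) (r + 1) (upd x i t).
pose d := y j - x j.
have upd_id z : upd z i (z i) = z.
  by apply/funext => k; rewrite /upd; case: eqP => // ->.
have upd_min z t : global_minimizer S z ->
    action S (i - r%:Z) (r + 1) z <= action S (i - r%:Z) (r + 1) (upd z i t).
  move=> /global_minimizerP; apply=> k kb; rewrite /upd; case: eqP => // ki.
  by move: kb; rewrite ki; lia.
have W_slope t : 0 <= t -> W (x i) + lambda * d * t <= W (x i + t).
  move=> t0; pose u := upd x i (x i + t).
  have ui : u i - y i = t by rewrite /u /upd eqxx -xyi; lra.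
  have uj : u j - y j = - d by rewrite /u /upd ifF /d; [lra|lia].
  have : action S (i - r%:Z) (r + 1) (seq_min u y)
      + action S (i - r%:Z) (r + 1) (seq_max u y) <=
      action S (i - r%:Z) (r + 1) u + action S (i - r%:Z) (r + 1) y
        - lambda * d * t.
    case: ij => ij.
      have := @action_twist (i - r%:Z) (r + 1) i u y _; rewrite -ij ui uj.
      by rewrite mulrN mulrAC; apply; lia.
    have := @action_twist (i - r%:Z) (r + 1) j u y _.
    rewrite (_ : j + 1 = i) ?ui ?uj; last by lia.
    by rewrite mulrN mulNr; apply; lia.
  have -> : seq_min u y = x.
    apply/funext => k; rewrite /seq_min /u /upd; case: eqP => [->|_].
      by rewrite -xyi min_r// lerDl.
    by rewrite min_l.
  have -> : seq_max u y = upd y i (y i + t).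
    apply/funext => k; rewrite /seq_max /u /upd; case: eqP => [->|_].
      by rewrite -xyi max_l// lerDl.
    by rewrite max_r.
  have := upd_min y (y i + t) ymin.
  rewrite /W upd_id -/u; lra.
have W_min t : W (x i) <= W t by rewrite /W upd_id upd_min.
have dW t : derivable W t 1 by exact: derivable_action.
(* Both [W] and [V] are minimal at [x i], so both derivatives vanish there. *)
pose V t := W t - lambda * d * t.
have dV t : derivable V t 1.
  by apply: derivableB => //; apply: derivableM => //; exact: derivable_cst.
have d0 : 0 <= lambda * d by rewrite mulr_ge0 ?(ltW lambda_gt0)// subr_ge0.
have V_min t : V (x i) <= V t.
  rewrite /V; have [xt|/ltW tx] := leP (x i) t.
    have /W_slope : 0 <= t - x i by rewrite subr_ge0.
    by rewrite [x i + _]addrC subrK; lra.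
  have := W_min t; have := ler_wpM2l d0 tx; lra.
have ab : x i - 1 <= x i + 1 by lra.
have xab : x i \in `]x i - 1, x i + 1[%R.
  by rewrite in_itv/=; apply/andP; split; lra.
have W'0 := @derive1_at_min _ W _ _ _ ab (fun t _ => dW t) xab
  (fun t _ => W_min t).
have V'0 := @derive1_at_min _ V _ _ _ ab (fun t _ => dV t) xab
  (fun t _ => V_min t).
have : 'D_1 V (x i) = 'D_1 W (x i) - lambda * d.
  rewrite /V deriveB// (_ : *%R (lambda * d) = (lambda * d) *: (id : R -> R))//.
  by rewrite deriveZ// derive_id [_ *: 1]mulr1.
rewrite !derive_val => /eqP; rewrite sub0r eq_sym oppr_eq0 mulf_eq0.
by rewrite gt_eqF//= /d subr_eq0 => /eqP ->.
Qed.

Lemma minimizer_touch x y i : global_minimizer S x -> global_minimizer S y ->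
  seq_le x y -> x i = y i -> x = y.
Proof.
move=> xmin ymin xy xyi.
have step j k : k = j + 1 \/ k = j - 1 -> x j = y j -> x k = y k.
  by move=> jk xyj; exact: minimizer_touch_step jk.
have up (n : nat) : x (i + n%:Z) = y (i + n%:Z) /\ x (i - n%:Z) = y (i - n%:Z).
  elim: n => [|n [IHu IHd]]; first by rewrite addr0.
  split; [apply: step IHu; left|apply: step IHd; right]; lia.
apply/funext => j; case: (leP i j) => ij.
  by have [+ _] := up (absz (j - i)%R); rewrite (_ : i + _ = j)//; lia.
by have [_] := up (absz (i - j)%R); rewrite (_ : i - _ = j)//; lia.
Qed.

(** If [x] exceeds [y] somewhere, it touches [seq_max x y] there, and so equals
    it. *)
Lemma minimizers_ordered x y : global_minimizer S x -> global_minimizer S y ->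
  global_minimizer S (seq_max x y) -> seq_le x y \/ seq_le y x.
Proof.
move=> xmin ymin Mmin.
have [[i xyi]|nxy] := pselect (exists i, y i < x i); last first.
  by left=> i; rewrite leNgt; apply/negP => xyi; apply: nxy; exists i.
right=> k; rewrite (@minimizer_touch x (seq_max x y) i)//.
- by rewrite /seq_max le_max lexx orbT.
- by move=> j; rewrite /seq_max le_max lexx.
- by rewrite /seq_max max_l// ltW.
Qed.

End StrongOrder.

(** * Sequences fixed by a translation *)

Section Translation.
Context {R : realType}.
Implicit Types (x : int -> R) (k l : int).

Lemma tau_tau k l k' l' x : tau k l (tau k' l' x) = tau (k + k') (l + l') x.
Proof.
apply/funext => i; rewrite /tau intrD (_ : i - (k + k') = i - k - k').
  by rewrite -addrA [l'%:~R + _]addrC.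
by rewrite opprD addrA.
Qed.

Lemma tau0 x : tau 0 0 x = x.
Proof. by apply/funext => i; rewrite /tau subr0 addr0. Qed.

Lemma tau_iter k l x (n : int) : tau k l x = x -> tau (n * k) (n * l) x = x.
Proof.
move=> kl; have nat_iter (m : nat) : tau (m%:Z * k) (m%:Z * l) x = x.
  elim: m => [|m IH]; first by rewrite !mul0r tau0.
  by rewrite intS !mulrDl !mul1r -tau_tau IH.
case: n => m; first exact: nat_iter.
by rewrite -{1}(nat_iter m.+1) tau_tau NegzE !mulNr !addNr tau0.
Qed.

Lemma tau_seq_max k l x y : tau k l (seq_max x y) = seq_max (tau k l x) (tau k l y).
Proof. by apply/funext => i; rewrite /tau /seq_max addr_maxl. Qed.

Lemma tau_seq_min k l x y : tau k l (seq_min x y) = seq_min (tau k l x) (tau k l y).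
Proof. by apply/funext => i; rewrite /tau /seq_min addr_minl. Qed.

End Translation.

Section Periodic.
Context {R : realType} (r : nat) (S : 'rV[R]_r.+1 -> R).
Context (S_inv : unit_invariant S).
Implicit Types (x y z u w : int -> R) (a i : int).

Lemma action_shift_period n l a m x (N : int) : tau n%:Z l x = x ->
  action S (a + N * n%:Z) m x = action S a m x.
Proof.
move=> /(tau_iter (- N)) xE; rewrite -{2}xE (action_tau S_inv).
by rewrite mulNr opprK.
Qed.

Lemma action_periods n l a x (N : nat) : tau n%:Z l x = x ->
  action S a (N * n) x = action S a n x *+ N.
Proof.
move=> xE; elim: N => [|N IH]; first by rewrite mul0n /action big_ord0.
rewrite mulSn action_cat mulrS -IH; congr (_ + _).
by rewrite -[X in a + X]mul1r (action_shift_period _ _ _ xE).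
Qed.

Lemma cut_cost_shift_period n l a x y (N : int) : tau n%:Z l x = x ->
  tau n%:Z l y = y -> cut_cost S (a + N * n%:Z) x y = cut_cost S a x y.
Proof.
move=> /(tau_iter (- N)) xE /(tau_iter (- N)) yE.
by rewrite -{2}xE -{2}yE (cut_cost_tau S_inv) mulNr opprK.
Qed.

(** Over [N] periods the difference of the actions grows linearly in [N], while
    the cost of splicing [u] into the minimizer [z] does not depend on [N]. *)
Lemma periodic_minimizer_action_le n l a z u : (0 < n)%N ->
  tau n%:Z l z = z -> tau n%:Z l u = u -> global_minimizer S z ->
  action S a n z <= action S a n u.
Proof.
move=> n0 zE uE zmin; rewrite leNgt; apply/negP => uz.
pose d := action S a n z - action S a n u.
pose C := cut_cost S a z u + cut_cost S a u z.
have d0 : 0 < d by rewrite subr_gt0.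
have NdC (N : nat) : (r <= N)%N -> d *+ N <= C.
  move=> rN; have rNn : (r <= N * n)%N by rewrite (leq_trans rN)// leq_pmulr.
  have := minimizer_cut u a zmin rNn.
  rewrite !(action_periods _ _ zE) !(action_periods _ _ uE) PoszM.
  rewrite (cut_cost_shift_period _ _ uE zE) /d mulrnBl /C; lra.
pose N := (r + Num.Def.archi_bound (C / d))%N.
have := NdC N (leq_addr _ _); apply/negP.
rewrite -ltNge -mulr_natl -ltr_pdivrMr//.
have [C0|C0] := leP 0 (C / d).
  by rewrite (lt_le_trans (archi_boundP C0))// ler_nat leq_addl.
by rewrite (lt_le_trans C0).
Qed.

Context (p : nat) (q : int).
Context (p_gt0 : (0 < p)%N).

Definition box_action (N : nat) x : R :=
  action S (- (N * p)%N%:Z) (2 * (N * p)) x.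

Lemma box_action_perturb x w a n :
    (forall i, ~~ (a <= i < a + n%:Z) -> w i = x i) ->
  \forall N \near \oo, box_action N x - box_action N w =
    action S (a - r%:Z) (r + n) x - action S (a - r%:Z) (r + n) w.
Proof.
move=> wx; exists (absz a + n + r)%N => // N /= NN.
have NNp : (N <= N * p)%N by rewrite leq_pmulr.
by rewrite /box_action; apply: action_perturb => //; lia.
Qed.

(** Copies of the perturbation [w - u], repeated with the length of the box as
    period, turn [w] into a sequence fixed by a multiple of the translation, and
    this does not change the action of [w] on the box. *)
Lemma periodic_minimizer_perturb z u w a n : tau p%:Z q z = z ->
    tau p%:Z q u = u -> global_minimizer S z ->
    (forall i, ~~ (a <= i < a + n%:Z) -> w i = u i) ->
  \forall N \near \oo, box_action N z <= box_action N w.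
Proof.
move=> zE uE zmin wu; exists (absz a + n + r).+1%N => // N /= NN.
have NNp : (N <= N * p)%N by rewrite leq_pmulr.
rewrite /box_action; set L := (N * p)%N in NNp *.
pose v i := w i - u i.
pose V i := v (((i + L%:Z) %% (2 * L)%N%:Z)%Z - L%:Z).
pose w' i := u i + V i.
have LE : (2 * L)%N%:Z = (2 * N)%N%:Z * p%:Z by rewrite /L mulnA PoszM.
have per x : tau p%:Z q x = x -> tau (2 * L)%N%:Z ((2 * N)%N%:Z * q) x = x.
  by move=> xE; rewrite LE tau_iter.
have w'E : tau (2 * L)%N%:Z ((2 * N)%N%:Z * q) w' = w'.
  apply/funext => i; rewrite /tau /w' addrAC.
  rewrite (_ : u (i - _) + _ = u i); last by rewrite -[in RHS](per u uE).
  rewrite /V; congr (_ + v (_ - _)).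
  by rewrite addrAC -[- _]mulN1r [_ + -1 * _]addrC modzMDl.
have w'w i : - L%:Z <= i < L%:Z + r%:Z -> w' i = w i.
  move=> ib; suff Vv : V i = v i by rewrite /w' Vv /v addrC subrK.
  have [iL|Li] := ltP i L%:Z.
    by rewrite /V modz_small ?addrK//; lia.
  rewrite [RHS](_ : _ = 0); last by rewrite /v wu ?subrr//; lia.
  rewrite /V (_ : i + L%:Z = 1 * (2 * L)%N%:Z + (i - L%:Z)); last by lia.
  rewrite modzMDl modz_small; last by lia.
  by rewrite /v wu ?subrr//; lia.
rewrite -(@eq_action _ _ _ _ _ w' w); last by move=> i ib; apply: w'w; lia.
by apply: periodic_minimizer_action_le w'E zmin; [lia|exact: per].
Qed.

End Periodic.

(** * Connections between fixed sequences *)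

Section Connection.
Context {R : realType} (r : nat) (S : 'rV[R]_r.+1 -> R).
Context (S_cont : continuous S).
Context (S_inv : unit_invariant S).
Context (p : nat) (q : int).
Context (p_gt0 : (0 < p)%N).
Implicit Types (x y z u w a b : int -> R).

Definition translate (N : int) x := tau (N * p%:Z) (N * q) x.

(** [tau] moves sequences to the right, so positive translates show the
    behaviour of [x] at minus infinity: [x] goes from [a] on the left to [b] on
    the right. *)
Definition connects x a b : Prop :=
  pointwise_cvg (fun N : nat => translate N%:Z x) a /\
  pointwise_cvg (fun N : nat => translate (- N%:Z) x) b.

Definition tau_fixed z : Prop := tau p%:Z q z = z.

Lemma translate_translate M N x : translate M (translate N x) = translate (M + N) x.
Proof. by rewrite /translate tau_tau !mulrDl. Qed.

Lemma translate_fixed N z : tau_fixed z -> translate N z = z.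
Proof. exact: tau_iter. Qed.

Lemma pointwise_cvg_near (X Y : nat -> int -> R) z :
    (forall i, \forall N \near \oo, X N i = Y N i) ->
  pointwise_cvg X z -> pointwise_cvg Y z.
Proof.
move=> XY Xz i; apply: cvg_trans (Xz i); apply: near_eq_cvg.
exact: XY.
Qed.

Lemma pointwise_cvg_sub (X : nat -> int -> R) z (c : nat) : (0 < c)%N ->
  pointwise_cvg X z -> pointwise_cvg (fun N => X (c * N)%N) z.
Proof.
move=> c0 Xz i.
have := @cvg_comp _ _ _ (muln c) (fun N => X N i) _ _ _ (@cvg_mulnl c c0) (Xz i).
exact.
Qed.

Lemma connects_periodic z : tau_fixed z -> connects z z z.
Proof.
move=> zE; split=> i;
  by under eq_cvg do rewrite translate_fixed//; exact: cvg_cst.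
Qed.

Lemma pointwise_cvg_max X Y x y : pointwise_cvg X x -> pointwise_cvg Y y ->
  pointwise_cvg (fun N => seq_max (X N) (Y N)) (seq_max x y).
Proof.
move=> Xx Yy i.
apply: (@continuous2_cvg _ _ _ _ _ _ _ _ Num.max) (Xx i) (Yy i).
exact: (@max_continuous _ R (x i, y i)).
Qed.

Lemma pointwise_cvg_min X Y x y : pointwise_cvg X x -> pointwise_cvg Y y ->
  pointwise_cvg (fun N => seq_min (X N) (Y N)) (seq_min x y).
Proof.
move=> Xx Yy i.
apply: (@continuous2_cvg _ _ _ _ _ _ _ _ Num.min) (Xx i) (Yy i).
exact: (@min_continuous _ R (x i, y i)).
Qed.

Lemma connects_max x y a b a' b' : connects x a b -> connects y a' b' ->
  connects (seq_max x y) (seq_max a a') (seq_max b b').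
Proof.
move=> [xa xb] [ya yb]; split.
  by under eq_fun do rewrite /translate tau_seq_max; exact: pointwise_cvg_max.
by under eq_fun do rewrite /translate tau_seq_max; exact: pointwise_cvg_max.
Qed.

Lemma connects_min x y a b a' b' : connects x a b -> connects y a' b' ->
  connects (seq_min x y) (seq_min a a') (seq_min b b').
Proof.
move=> [xa xb] [ya yb]; split.
  by under eq_fun do rewrite /translate tau_seq_min; exact: pointwise_cvg_min.
by under eq_fun do rewrite /translate tau_seq_min; exact: pointwise_cvg_min.
Qed.

Lemma connects_perturb x a b w (c : int) (n : nat) :
    (forall i, ~~ (c <= i < c + n%:Z) -> w i = x i) ->
  connects x a b -> connects w a b.
Proof.
move=> wx [xa xb]; split; [apply: pointwise_cvg_near xa|
    apply: pointwise_cvg_near xb] => i;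
  exists (absz i + absz c + n).+1 => // N /= NN; rewrite /translate /tau wx//;
  have : (N <= N * p)%N by rewrite leq_pmulr.
- by rewrite -PoszM; lia.
- by rewrite mulNr -PoszM; lia.
Qed.

Lemma cut_cost_translate (N : int) x y :
  cut_cost S (N * p%:Z) x y =
  cut_cost S 0 (translate (- N) x) (translate (- N) y).
Proof. by rewrite (cut_cost_tau S_inv) sub0r mulNr opprK. Qed.

(** The competitor for [x] equals [M] up to the site [N * p], then the translate
    of [m] by [2 * N] periods up to [3 * N * p], and [x] outside this block,
    which starts at [- N * p].  On the second half of the block the action of
    [x] is at least that of the minimizer [b], again up to splicing.  Each of
    the five splices joins two sequences with the same limit. *)
Lemma action_connection x a z b M m :
    global_minimizer S x -> global_minimizer S b -> tau_fixed b ->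
    connects x a b -> connects M a z -> connects m z b ->
  exists2 e : nat -> R, e N @[N --> \oo] --> (0 : R) &
  \forall N \near \oo, box_action S p N x + box_action S p N b <=
    box_action S p N M + box_action S p N m + e N.
Proof.
move=> xmin bmin bE [xa xb] [Ma Mz] [mz mb].
pose m' (N : nat) := translate (2 * N)%N%:Z m.
pose u (N : nat) := splice (N%:Z * p%:Z) M (m' N).
have xb3 := pointwise_cvg_sub (ltn0Sn 2) xb.
have bb (f : nat -> int) : pointwise_cvg (fun N => translate (f N) b) b.
  by move=> i; under eq_cvg do rewrite translate_fixed//; exact: cvg_cst.
have ua : pointwise_cvg (fun N : nat => translate N%:Z (u N)) a.
  apply: pointwise_cvg_near Ma => i; exists (absz i).+1 => // N /= iN.
  rewrite /translate /tau /u /splice ifT// -PoszM.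
  have : (N <= N * p)%N by rewrite leq_pmulr.
  by lia.
have ub : pointwise_cvg (fun N : nat => translate (- (3 * N)%N%:Z) (u N)) b.
  apply: pointwise_cvg_near mb => i; exists (absz i).+1 => // N /= iN.
  have -> : translate (- N%:Z) m = translate (- (3 * N)%N%:Z) (m' N).
    by rewrite translate_translate; congr translate; lia.
  rewrite /translate /tau /u /splice ifF// mulNr PoszM -mulrA -PoszM.
  have : (N <= N * p)%N by rewrite leq_pmulr.
  by lia.
have m'z : pointwise_cvg (fun N : nat => translate (- N%:Z) (m' N)) z.
  apply: pointwise_cvg_near mz => i; apply: nearW => N.
  by rewrite translate_translate; congr translate; lia.
pose D (k : nat -> int) X Y N :=
  cut_cost S 0 (translate (k N) (X N)) (translate (k N) (Y N)).
pose e := D Posz (fun=> x) u \+ D (fun N => - (3 * N)%N%:Z) u (fun=> x)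
  \+ D (fun N => - N%:Z) (fun=> M) m' \+ D (fun N => - N%:Z) (fun=> b) (fun=> x)
  \+ D (fun N => - (3 * N)%N%:Z) (fun=> x) (fun=> b).
exists e.
  rewrite -[X in _ --> X](addr0 0) -[X in _ --> X + _](addr0 0)
    -[X in _ --> X + _ + _](addr0 0) -[X in _ --> X + _ + _ + _](addr0 0).
  by do !apply: cvgD; apply: cvg_cut_cost => //; exact: bb.
exists r => // N /= rN.
have NNp : (N <= N * p)%N by rewrite leq_pmulr.
have rL : (r <= 2 * (N * p))%N by lia.
have rL2 : (r <= 2 * (N * p) + 2 * (N * p))%N by lia.
have L1 : - (N * p)%N%:Z + (2 * (N * p))%N%:Z = N%:Z * p%:Z by lia.
have L3 : - (N * p)%N%:Z + (2 * (N * p) + 2 * (N * p))%N%:Z =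
  (3 * N)%N%:Z * p%:Z by lia.
have L13 : N%:Z * p%:Z + (2 * (N * p))%N%:Z = (3 * N)%N%:Z * p%:Z by lia.
have L0 : - (N * p)%N%:Z = - N%:Z * p%:Z by lia.
have cut_x := minimizer_cut (u N) (- (N * p)%N%:Z) xmin rL2.
rewrite L3 in cut_x.
have cut_u := action_splice S (- (N * p)%N%:Z) (2 * (N * p)) M (m' N) rL.
rewrite L1 -/(u N) in cut_u.
have cut_b := minimizer_cut x (N%:Z * p%:Z) bmin rL.
rewrite L13 in cut_b.
have split_x := action_cat S (- (N * p)%N%:Z) (2 * (N * p)) (2 * (N * p)) x.
rewrite L1 in split_x.
have back : N%:Z * p%:Z - (2 * N)%N%:Z * p%:Z = - (N * p)%N%:Z by lia.
have m'E : action S (N%:Z * p%:Z) (2 * (N * p)) (m' N) = box_action S p N m.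
  by rewrite (action_tau S_inv) back.
have bE' : action S (N%:Z * p%:Z) (2 * (N * p)) b = box_action S p N b.
  rewrite -{1}(translate_fixed (2 * N)%N%:Z bE) (action_tau S_inv).
  by rewrite back.
have eE : e N = cut_cost S (- (N * p)%N%:Z) x (u N)
   + cut_cost S ((3 * N)%N%:Z * p%:Z) (u N) x
   + cut_cost S (N%:Z * p%:Z) M (m' N) + cut_cost S (N%:Z * p%:Z) b x
   + cut_cost S ((3 * N)%N%:Z * p%:Z) x b.
  by rewrite L0 !cut_cost_translate opprK.
rewrite eE -m'E -bE' /box_action; lra.
Qed.

End Connection.

(** * Ordering of connections *)

Section Ordering.
Context {R : realType} (r : nat) (lambda : R) (S : 'rV[R]_r.+1 -> R).
Context (S_cont : continuous S).
Context (S_der : forall k, has_partial k S).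
Context (S_inv : unit_invariant S).
Context (r_gt0 : (0 < r)%N).
Context (lambda_gt0 : 0 < lambda).
Context (S_sub : twist_submodular lambda S).
Context (p : nat) (q : int).
Context (p_gt0 : (0 < p)%N).
Implicit Types (x y z u w a b : int -> R).

Local Notation tau_fixed := (tau_fixed p q).
Local Notation connects := (connects p q).
Local Notation box_action := (box_action S p).

(** By submodularity the bound says that no local perturbation [w] lowers the
    action of [seq_max x y] by more than [e N], hence that [seq_max x y] is a
    minimizer. *)
Lemma ordered_of_box_action x y :
    global_minimizer S x -> global_minimizer S y ->
    (forall w (c : int) (n : nat),
      (forall i, ~~ (c <= i < c + n%:Z) -> w i = seq_max x y i) ->
      exists2 e : nat -> R, e N @[N --> \oo] --> (0 : R) &
      \forall N \near \oo, box_action N x + box_action N y <=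
        box_action N w + box_action N (seq_min x y) + e N) ->
  seq_le x y \/ seq_le y x.
Proof.
move=> xmin ymin bound.
apply: (minimizers_ordered S_sub S_der r_gt0 lambda_gt0) => //.
apply/global_minimizerP => c n w wM; have [e e0 le_e] := bound w c n wM.
rewrite -subr_le0; apply: (cvgr_to_ge e0).
have Mw := box_action_perturb S p_gt0 wM.
near=> N.
have <- : box_action N (seq_max x y) - box_action N w =
    action S (c - r%:Z) (r + n) (seq_max x y) - action S (c - r%:Z) (r + n) w.
  by near: N; exact: Mw.
have : box_action N x + box_action N y <=
  box_action N w + box_action N (seq_min x y) + e N by near: N; exact: le_e.
have := action_submodular S_sub (- (N * p)%N%:Z) (2 * (N * p)) x y.
rewrite /box_action; lra.
Unshelve. all: by end_near. Qed.

Lemma tau_fixed_min x y : tau_fixed x -> tau_fixed y -> tau_fixed (seq_min x y).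
Proof. by rewrite /tau_fixed tau_seq_min => -> ->. Qed.

Lemma tau_fixed_max x y : tau_fixed x -> tau_fixed y -> tau_fixed (seq_max x y).
Proof. by rewrite /tau_fixed tau_seq_max => -> ->. Qed.

Lemma periodic_minimizers_ordered x y : tau_fixed x -> tau_fixed y ->
  global_minimizer S x -> global_minimizer S y -> seq_le x y \/ seq_le y x.
Proof.
move=> xE yE xmin ymin; apply: ordered_of_box_action => // w c n wM.
exists (fun=> 0); first exact: cvg_cst.
have xw := periodic_minimizer_perturb S_inv p_gt0 xE (tau_fixed_max xE yE)
  xmin wM.
have ym := periodic_minimizer_perturb S_inv p_gt0 yE (tau_fixed_min xE yE) ymin
  (a := 0) (n := 0%N) (fun i _ => erefl).
by apply: filterS2 xw ym => N xw ym; rewrite addr0 lerD.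
Qed.

Lemma seq_max_l x y : seq_le y x -> seq_max x y = x.
Proof. by move=> yx; apply/funext => i; exact: max_l. Qed.
Lemma seq_min_r x y : seq_le y x -> seq_min x y = y.
Proof. by move=> yx; apply/funext => i; exact: min_r. Qed.
Lemma seq_max_r x y : seq_le x y -> seq_max x y = y.
Proof. by move=> yx; apply/funext => i; exact: max_r. Qed.
Lemma seq_min_l x y : seq_le x y -> seq_min x y = x.
Proof. by move=> yx; apply/funext => i; exact: min_l. Qed.

(** The maximum has the same ends as [x], and the minimum has the same ends as
    [y]; [action_connection] then compares each pair separately, the other half
    of the chain being [b] or [b'] itself. *)
Lemma connections_ordered_of_le x y a b a' b' :
    global_minimizer S x -> global_minimizer S y ->
    global_minimizer S b -> global_minimizer S b' -> tau_fixed b -> tau_fixed b' ->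
    connects x a b -> connects y a' b' -> seq_le a' a -> seq_le b' b ->
  seq_le x y \/ seq_le y x.
Proof.
move=> xmin ymin bmin b'min bE b'E xab yab aa bb.
apply: ordered_of_box_action => // w c n wM.
have wab : connects w a b.
  rewrite -(seq_max_l aa) -(seq_max_l bb); apply: connects_perturb wM _ => //.
  exact: connects_max.
have mab : connects (seq_min x y) a' b'.
  by rewrite -(seq_min_r aa) -(seq_min_r bb); exact: connects_min.
have [e e0 le_e] := action_connection S_cont S_inv p_gt0 xmin bmin bE xab wab
  (connects_periodic bE).
have [e' e'0 le_e'] := action_connection S_cont S_inv p_gt0 ymin b'min b'E yab mab
  (connects_periodic b'E).
exists (e \+ e'); first by rewrite -[X in _ --> X](addr0 0); exact: cvgD.
by apply: filterS2 le_e le_e' => N /=; lra.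
Qed.

(** The minimum and the maximum of [x] and [z] form a chain through [z] from [a]
    to [b].  The maximum is its first half if [x] falls, its second half if [x]
    rises. *)
Lemma connection_periodic_ordered x a b z :
    global_minimizer S x -> global_minimizer S b -> global_minimizer S z ->
    tau_fixed b -> tau_fixed z -> connects x a b ->
    seq_le b z /\ seq_le z a \/ seq_le a z /\ seq_le z b ->
  seq_le x z \/ seq_le z x.
Proof.
move=> xmin bmin zmin bE zE xab zab; apply: ordered_of_box_action => // w c n wM.
have zz := connects_periodic zE.
have Mc : connects w (seq_max a z) (seq_max b z).
  by apply: connects_perturb wM _ => //; exact: connects_max.
have mc : connects (seq_min x z) (seq_min a z) (seq_min b z) by exact: connects_min.
have zb : \forall N \near \oo, box_action N z <= box_action N b.
  exact: (periodic_minimizer_perturb S_inv p_gt0 zE bE zmin (a := 0) (n := 0%N)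
    (fun i _ => erefl)).
suff [e e0 le_e] : exists2 e : nat -> R, e N @[N --> \oo] --> (0 : R) &
    \forall N \near \oo, box_action N x + box_action N b <=
    box_action N w + box_action N (seq_min x z) + e N.
  by exists e => //; apply: filterS2 le_e zb => N; lra.
case: zab => [[bz za]|[az zb']].
  apply: (action_connection S_cont S_inv p_gt0 xmin bmin bE xab (z := z)).
    by move: Mc; rewrite (seq_max_l za) (seq_max_r bz).
  by move: mc; rewrite (seq_min_r za) (seq_min_l bz).
have [||e e0 le_e] := action_connection S_cont S_inv p_gt0 xmin bmin bE xab
  (z := z) (M := seq_min x z) (m := w).
- by move: mc; rewrite (seq_min_l az) (seq_min_r zb').
- by move: Mc; rewrite (seq_max_r az) (seq_max_l zb').
by exists e => //; apply: filterS le_e => N; rewrite [box_action N w + _]addrC.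
Qed.

Lemma connects_le x a b z : connects x a b -> tau_fixed z -> seq_le x z ->
  seq_le a z /\ seq_le b z.
Proof.
move=> [xa xb] zE xz; split=> i.
  apply: cvgr_to_le (xa i) _; apply: nearW => N.
  by rewrite -(translate_fixed N%:Z zE) lerD2r.
apply: cvgr_to_le (xb i) _; apply: nearW => N.
by rewrite -(translate_fixed (- N%:Z) zE) lerD2r.
Qed.

Lemma connects_ge x a b z : connects x a b -> tau_fixed z -> seq_le z x ->
  seq_le z a /\ seq_le z b.
Proof.
move=> [xa xb] zE zx; split=> i.
  apply: cvgr_to_ge (xa i) _; apply: nearW => N.
  by rewrite -(translate_fixed N%:Z zE) lerD2r.
apply: cvgr_to_ge (xb i) _; apply: nearW => N.
by rewrite -(translate_fixed (- N%:Z) zE) lerD2r.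
Qed.

Lemma seq_le_trans x y z : seq_le x y -> seq_le y z -> seq_le x z.
Proof. by move=> xy yz i; exact: le_trans (xy i) (yz i). Qed.

(** A fixed [z] above or below [x] is also above or below both ends of [x]. *)
Lemma connection_avoids_periodic x a b z :
    global_minimizer S x -> global_minimizer S a -> global_minimizer S b ->
    global_minimizer S z -> tau_fixed a -> tau_fixed b -> tau_fixed z ->
    connects x a b ->
  seq_le a z /\ seq_le b z \/ seq_le z a /\ seq_le z b.
Proof.
move=> xmin amin bmin zmin aE bE zE xab.
have between : seq_le b z /\ seq_le z a \/ seq_le a z /\ seq_le z b ->
    seq_le a z /\ seq_le b z \/ seq_le z a /\ seq_le z b.
  move=> /(connection_periodic_ordered xmin bmin zmin bE zE xab) [xz|zx].
    by left; exact: (connects_le xab).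
  by right; exact: (connects_ge xab).
have [az|za] := periodic_minimizers_ordered aE zE amin zmin;
  have [bz|zb] := periodic_minimizers_ordered bE zE bmin zmin.
- by left.
- by apply: between; right.
- by apply: between; left.
- by right.
Qed.

(** If the left ends and the right ends are ordered in opposite senses, monotony
    places an end of one connection between the ends of the other, where
    [connection_avoids_periodic] forces an equality. *)
Lemma connections_ordered x y a b a' b' :
    global_minimizer S x -> global_minimizer S y ->
    global_minimizer S a -> global_minimizer S b ->
    global_minimizer S a' -> global_minimizer S b' ->
    tau_fixed a -> tau_fixed b -> tau_fixed a' -> tau_fixed b' ->
    connects x a b -> connects y a' b' ->
    seq_le b a /\ seq_le b' a' \/ seq_le a b /\ seq_le a' b' ->
  seq_le x y \/ seq_le y x.
Proof.
move=> xmin ymin amin bmin a'min b'min aE bE a'E b'E xab yab same.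
have Hx z zmin zE :=
  @connection_avoids_periodic x a b z xmin amin bmin zmin aE bE zE xab.
have Hy z zmin zE :=
  @connection_avoids_periodic y a' b' z ymin a'min b'min zmin a'E b'E zE yab.
have up : seq_le a' a -> seq_le b' b -> seq_le x y \/ seq_le y x.
  exact: (@connections_ordered_of_le x y a b a' b').
have down : seq_le a a' -> seq_le b b' -> seq_le x y \/ seq_le y x.
  by move=> aa bb; rewrite or_comm;
    exact: (@connections_ordered_of_le y x a' b' a b).
have [aa'|a'a] := periodic_minimizers_ordered aE a'E amin a'min;
  have [bb'|b'b] := periodic_minimizers_ordered bE b'E bmin b'min.
- exact: down.
- case: same => [[ba _]|[_ a'b']].
    have [[a'b _]|[_ bb']] := Hy b bmin bE; last exact: down.
    by apply: up => //; exact: seq_le_trans a'b ba.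
  have [[_ ba']|[a'a _]] := Hx a' a'min a'E; last exact: up.
  by apply: down => //; exact: seq_le_trans ba' a'b'.
- case: same => [[_ b'a']|[ab _]].
    have [[ab' _]|[_ b'b]] := Hx b' b'min b'E; last exact: up.
    by apply: down => //; exact: seq_le_trans ab' b'a'.
  have [[_ b'a]|[aa' _]] := Hy a amin aE; last exact: down.
  by apply: up => //; exact: seq_le_trans b'a ab.
- exact: up.
Qed.

End Ordering.

(** * Asymptotics of Birkhoff sequences *)

Section Limits.
Context {R : realType} (r : nat) (S : 'rV[R]_r.+1 -> R).
Context (S_cont : continuous S).
Context (S_inv : unit_invariant S).
Context (p : nat) (q : int).
Implicit Types (x y z u w a b : int -> R).

Lemma global_minimizer_tau (k l : int) x :
  global_minimizer S x -> global_minimizer S (tau k l x).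
Proof.
move=> /global_minimizerP xmin; apply/global_minimizerP => c n w wx.
have wE : tau k l (tau (- k) (- l) w) = w by rewrite tau_tau !addrN tau0.
rewrite -wE 2!(action_tau S_inv) addrAC; apply: xmin => i ib.
rewrite /tau opprK wx; last by lia.
by rewrite /tau addrK intrN addrK.
Qed.

Lemma global_minimizer_cvg (X : nat -> int -> R) z :
    (forall N, global_minimizer S (X N)) -> pointwise_cvg X z ->
  global_minimizer S z.
Proof.
move=> Xmin Xz; apply/global_minimizerP => c n w wz.
pose Y N i := X N i + (w i - z i).
have Yw : pointwise_cvg Y w.
  move=> i; rewrite -[X in _ --> X](subrKC (z i)); apply: cvgD; first exact: Xz.
  exact: cvg_cst.
apply: (ler_cvg_to (cvg_action S_cont (a := c - r%:Z) (n := (r + n)%N) Xz)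
  (cvg_action S_cont (a := c - r%:Z) (n := (r + n)%N) Yw)).
apply: nearW => N; move: (Xmin N) => /global_minimizerP; apply=> i ib.
by rewrite /Y wz// subrr addr0.
Qed.

Lemma connects_minimizer x a b : global_minimizer S x -> connects p q x a b ->
  global_minimizer S a /\ global_minimizer S b.
Proof.
move=> xmin [xa xb]; split; [apply: global_minimizer_cvg xa|
  apply: global_minimizer_cvg xb] => N; exact: global_minimizer_tau.
Qed.

Lemma connects_tau_fixed x a b : connects p q x a b ->
  tau_fixed p q a /\ tau_fixed p q b.
Proof.
have tau_translate (N : int) :
    tau p%:Z q (translate p q N x) = translate p q (N + 1) x.
  by rewrite /translate tau_tau !mulrDl !mul1r addrC [_ + q]addrC.
have tau_cvg (X : nat -> int -> R) z : pointwise_cvg X z ->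
    pointwise_cvg (fun N => tau p%:Z q (X N)) (tau p%:Z q z).
  by move=> Xz i; apply: cvgD; [exact: Xz|exact: cvg_cst].
move=> [xa xb]; split; apply/funext => i.
  have xa1 := tau_cvg _ _ xa i.
  have xa2 : translate p q N.+1%:Z x i @[N --> \oo] --> a i.
    by have := xa i; rewrite -cvg_shiftS.
  have xa3 : tau p%:Z q (translate p q N%:Z x) i @[N --> \oo] --> a i.
    by under eq_cvg do rewrite tau_translate -PoszD addn1.
  exact: (cvg_unique (@norm_hausdorff _ R) xa1 xa3).
have xb1 : tau p%:Z q (translate p q (- N.+1%:Z) x) i @[N --> \oo] -->
    tau p%:Z q b i.
  by have := tau_cvg _ _ xb i; rewrite -cvg_shiftS.
have predE (N : nat) : - N.+1%:Z + 1 = - N%:Z by lia.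
have xb2 : tau p%:Z q (translate p q (- N.+1%:Z) x) i @[N --> \oo] --> b i.
  by under eq_cvg do rewrite tau_translate predE; exact: xb.
exact: (cvg_unique (@norm_hausdorff _ R) xb1 xb2).
Qed.

End Limits.

Section Birkhoff.
Context {R : realType}.
Implicit Types (x : int -> R).

(** Iteration gives [x (k * m) <= x 0 + m * l]; divide by [k * m]. *)
Lemma rotation_number_le (k : nat) (l : int) x nu : (0 < k)%N ->
  rotation_number x nu -> seq_le x (tau k%:Z l x) -> nu <= l%:~R / k%:R.
Proof.
move=> k0 [xnu _] xkl.
have kR0 : (0 : R) < k%:R by rewrite ltr0n.
have iter_le (m : nat) : x (k * m)%N%:Z <= x 0 + m%:R * l%:~R.
  elim: m => [|m IH]; first by rewrite muln0 mul0r addr0.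
  have := xkl (k * m.+1)%N%:Z; rewrite /tau (_ : _ - _ = (k * m)%N%:Z); last by lia.
  by rewrite -natr1 mulrDl mul1r; lra.
have sub_cvg : x (k * m.+1)%N%:Z / (k * m.+1)%N%:R @[m --> \oo] --> nu.
  have := cvg_comp _ _ (@cvg_mulnl k k0) xnu.
  by rewrite -cvg_shiftS.
have bound_cvg : x 0 / k%:R * m.+1%:R^-1 + l%:~R / k%:R @[m --> \oo]
    --> x 0 / k%:R * 0 + l%:~R / k%:R.
  apply: cvgD; last exact: cvg_cst.
  by apply: cvgM; [exact: cvg_cst|exact: cvg_harmonic].
rewrite -[leRHS]add0r -[X in X + _](mulr0 (x 0 / k%:R)).
apply: (ler_cvg_to sub_cvg bound_cvg); apply: nearW => m.
rewrite natrM ler_pdivrMr ?mulr_gt0//.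
have -> : (x 0 / k%:R / m.+1%:R + l%:~R / k%:R) * (k%:R * m.+1%:R) =
   x 0 + m.+1%:R * l%:~R by field; rewrite !gt_eqF.
exact: iter_le.
Qed.

Lemma rotation_number_ge (k : nat) (l : int) x nu : (0 < k)%N ->
  rotation_number x nu -> seq_le (tau k%:Z l x) x -> l%:~R / k%:R <= nu.
Proof.
move=> k0 [xnu xnuN] xkl; rewrite -lerN2 -mulNr -intrN.
apply: (@rotation_number_le k (- l) (fun i => - x i)) => //.
  by split; under eq_cvg do rewrite mulNr; exact: cvgN.
by move=> i; rewrite /tau intrN -opprD lerN2; exact: xkl.
Qed.

Context (p : nat) (q : int).
Context (p_gt0 : (0 < p)%N).

(** If the translate of [x] by [N] periods, lowered by 1, were not below [x], the
    Birkhoff property would put it above [x], and the rotation number would be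
    at most [(N * q - 1) / (N * p)].  The lower bound is similar. *)
Lemma birkhoff_translate_bounded x (N : nat) (i : int) :
    birkhoff x -> rotation_number x (q%:~R / p%:~R) ->
  x i - 1 <= translate p q N%:Z x i <= x i + 1.
Proof.
move=> xB xrot; case: N => [|N].
  by rewrite /translate /tau !mul0r subr0 addr0 lerBlDr !lerDl ler01.
set k := (N.+1 * p)%N; have k0 : (0 < k)%N by rewrite muln_gt0.
have kR : (0 : R) < k%:R by rewrite ltr0n.
have slope : q%:~R / p%:~R = (N.+1%:Z * q)%:~R / k%:R :> R.
  rewrite intrM natrM -!pmulrn; field.
  by rewrite nat1r !pnatr_eq0/= -lt0n p_gt0.
have translateE l : translate p q N.+1%:Z x i =
    tau k%:Z l x i - l%:~R + (N.+1%:Z * q)%:~R.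
  by rewrite /translate /tau -PoszM addrK.
rewrite slope in xrot; apply/andP; split.
  pose l := N.+1%:Z * q + 1.
  have [xl|/(_ i) xl] := xB k%:Z l.
    have := rotation_number_ge k0 xrot xl.
    by rewrite ler_pM2r ?invr_gt0// ler_int /l => H; exfalso; lia.
  by rewrite (translateE l) {2}/l intrD; lra.
pose l := N.+1%:Z * q - 1.
have [/(_ i) xl|xl] := xB k%:Z l.
  by rewrite (translateE l) {2}/l intrB; lra.
have := rotation_number_le k0 xrot xl.
by rewrite ler_pM2r ?invr_gt0// ler_int /l => H; exfalso; lia.
Qed.

Lemma monotone_int_cvg (g : int -> R) (c d : R) :
    (forall N, g N <= g (N + 1)) -> (forall N, c <= g N <= d) ->
  exists st : R * R, [/\ st.2 <= st.1, g N%:Z @[N --> \oo] --> st.1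
    & g (- N%:Z) @[N --> \oo] --> st.2].
Proof.
move=> g_nd g_bd.
have up : cvgn (fun N : nat => g N%:Z).
  apply: nondecreasing_is_cvgn.
    by apply/nondecreasing_seqP => N; rewrite -addn1 PoszD; exact: g_nd.
  by exists d => _ [N _ <-]; have /andP[] := g_bd N%:Z.
have predE (N : nat) : - N.+1%:Z + 1 = - N%:Z by lia.
have down : cvgn (fun N : nat => g (- N%:Z)).
  apply: nonincreasing_is_cvgn.
    by apply/nonincreasing_seqP => N; have := g_nd (- N.+1%:Z); rewrite predE.
  by exists c => _ [N _ <-]; have /andP[] := g_bd (- N%:Z).
exists (limn (fun N : nat => g N%:Z), limn (fun N : nat => g (- N%:Z))).
split=> //=.
have nd_nat (n m : nat) : g (- n%:Z) <= g m%:Z.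
  have -> : m%:Z = - n%:Z + (n + m)%N%:Z by lia.
  elim: (n + m)%N => [|j IH]; first by rewrite addr0.
  by rewrite (le_trans IH)// -addn1 PoszD addrA.
apply: (ler_cvg_to down up); apply: nearW => N; exact: nd_nat.
Qed.

Lemma birkhoff_connects x :
    birkhoff x -> rotation_number x (q%:~R / p%:~R) ->
  (seq_le x (tau p%:Z q x) ->
    exists a b, connects p q x a b /\ seq_le b a) /\
  (seq_le (tau p%:Z q x) x ->
    exists a b, connects p q x a b /\ seq_le a b).
Proof.
move=> xB xrot.
have bounded (i N : int) : x i - 1 <= translate p q N x i <= x i + 1.
  case: N => N; first exact: birkhoff_translate_bounded.
  have := birkhoff_translate_bounded N.+1 (i + N.+1%:Z * p%:Z) xB xrot.
  by rewrite NegzE /translate /tau addrK !mulNr opprK intrN; lra.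
have translateS (N i : int) :
    translate p q (N + 1) x i = translate p q N (tau p%:Z q x) i.
  by rewrite /translate tau_tau !mulrDl !mul1r.
split=> mono.
  have /choice[st stP] : forall i, exists st : R * R, [/\ st.2 <= st.1,
      translate p q N%:Z x i @[N --> \oo] --> st.1
      & translate p q (- N%:Z) x i @[N --> \oo] --> st.2].
    move=> i; apply: (@monotone_int_cvg (fun N => translate p q N x i)
      (x i - 1) (x i + 1)) => // N.
    by rewrite translateS lerD2r; exact: mono.
  exists (fun i => (st i).1), (fun i => (st i).2).
  by split; [split|] => i; have [] := stP i.
have /choice[st stP] : forall i, exists st : R * R, [/\ st.2 <= st.1,
    translate p q (- N%:Z) x i @[N --> \oo] --> st.1
    & translate p q (- - N%:Z) x i @[N --> \oo] --> st.2].
  move=> i; apply: (@monotone_int_cvg (fun N => translate p q (- N) x i)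
    (x i - 1) (x i + 1)) => // N.
  rewrite -[X in translate _ _ X x i <= _](subrK 1) translateS opprD.
  by rewrite lerD2r; exact: mono.
exists (fun i => (st i).2), (fun i => (st i).1).
split; [split|] => i; have [st21 st1 st2] := stP i => //.
by under eq_cvg do rewrite -[N in translate _ _ N](opprK).
Qed.

End Birkhoff.

Theorem theoremA6 (R : realType) (r : nat) (K lambda : R)
    (S : 'rV[R]_r.+1 -> R) :
  (1 <= r)%N -> 0 < K -> 0 < lambda -> weak_twist_energy K lambda S ->
  forall p q : int, 1 <= p ->
    ordered (BMplus S p q) /\ ordered (BMminus S p q).
Proof.
move=> r_gt0 _ lambda_gt0 S_wt p' q p1.
have [p pE p_gt0] : exists2 p : nat, p' = p%:Z & (0 < p)%N.
  by exists (absz p'); lia.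
rewrite {p' p1}pE.
have [[S_cont S_der _ _ _] [f [SE fP _ _]]] := S_wt.
have S_inv (i : int) (x : int -> R) :
    local_term S i (fun j => x j + 1) = local_term S i x.
  rewrite /local_term !SE; apply: eq_bigr => j _; rewrite !mxE.
  by have [_ -> _ _] := fP j.
have S_sub := weak_twist_submodular r_gt0 lambda_gt0 S_wt.
have limitP x a b := @connects_minimizer _ _ _ S_cont S_inv p q x a b.
have fixP x a b := @connects_tau_fixed R p q x a b.
have order_cc := connections_ordered S_cont S_der S_inv r_gt0 lambda_gt0 S_sub
  (q := q) p_gt0.
split=> x y [xmin [[xB xrot] xmono]] [ymin [[yB yrot] ymono]].
  have [/(_ xmono) [a [b [xab ba]]] _] := birkhoff_connects p_gt0 xB xrot.
  have [/(_ ymono) [a' [b' [yab ba']]] _] := birkhoff_connects p_gt0 yB yrot.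
  have [amin bmin] := limitP _ _ _ xmin xab; have [aE bE] := fixP _ _ _ xab.
  have [a'min b'min] := limitP _ _ _ ymin yab; have [a'E b'E] := fixP _ _ _ yab.
  by apply: (order_cc x y a b a' b') => //; left.
have [_ /(_ xmono) [a [b [xab ab]]]] := birkhoff_connects p_gt0 xB xrot.
have [_ /(_ ymono) [a' [b' [yab ab']]]] := birkhoff_connects p_gt0 yB yrot.
have [amin bmin] := limitP _ _ _ xmin xab; have [aE bE] := fixP _ _ _ xab.
have [a'min b'min] := limitP _ _ _ ymin yab; have [a'E b'E] := fixP _ _ _ yab.
by apply: (order_cc x y a b a' b') => //; right.
Qed.
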